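(* Let $X$ be a finite-dimensional Euclidean or Hermitian space, and let $M,N\in\bigwedge X$ be nonzero. Let $b=\max\{|M|_{\mathrm{bot}},|N|_{\mathrm{bot}}\}$ and $t=\min\{|M|_{\mathrm{top}},|N|_{\mathrm{top}}\}$. (i) If $\dim(\lfloor M\rfloor+\lfloor N\rfloor)\ge t+2$ then $M+N$ is inner balanced, i.e. $\lfloor M+N\rfloor=\lfloor M\rfloor\cap\lfloor N\rfloor$, and $|M+N|_{\mathrm{in}}\le b-2$. (ii) If $\dim(\lceil M\rceil\cap\lceil N\rceil)\le b-2$ then $M+N$ is outer balanced, i.e. $\lceil M+N\rceil=\lceil M\rceil+\lceil N\rceil$, and $|M+N|_{\mathrm{out}}\ge t+2$.
   Context: $X$ is a Euclidean (real) or Hermitian (complex) inner product space of finite dimension, with product $\langle\cdot,\cdot\rangle$ (conjugate-linear in the first argument in the complex case), and $\bigwedge X$ is its exterior algebra with the induced inner product (different grades orthogonal, $\langle x_1\wedge\cdots\wedge x_p,y_1\wedge\cdots\wedge y_p\rangle=\det(\langle x_i,y_j\rangle)$). The left contraction $M\lrcorner N$ is defined by $\langle L,M\lrcorner N\rangle=\langle M\wedge L,N\rangle$ for all $L$. Inner and outer spaces: $\lfloor M\rfloor=\{v\in X:v\wedge M=0\}$ and $\lceil M\rceil=\{v\in X:v\lrcorner M=0\}^\perp$. Let $(M)_p$ be the component of grade $p$ of $M$. For $M\neq0$, the inner, outer, bottom and top grades are $|M|_{\mathrm{in}}=\dim\lfloor M\rfloor$, $|M|_{\mathrm{out}}=\dim\lceil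 M\rceil$, $|M|_{\mathrm{bot}}=\min\{p:(M)_p\neq0\}$, $|M|_{\mathrm{top}}=\max\{p:(M)_p\neq0\}$. *)

(* Defs.v *)
From HB Require Import structures.
From mathcomp Require Import all_boot all_order all_fingroup all_algebra.
From mathcomp Require classical_sets.
From mathcomp Require Import complex reals ring.

Set Implicit Arguments.
Unset Strict Implicit.
Unset Printing Implicit Defensive.

Import Order.TTheory GRing.Theory Num.Theory.
Local Open Scope ring_scope.

Variant space_kind := Euclidean | Hermitian.

Definition scalars (R : realType) (s : space_kind) : numFieldType :=
  match s with
  | Euclidean => R
  | Hermitian => R[i]
  end.

Definition conjugation (R : realType) (s : space_kind) :
    involutive_rmorphism (scalars R s) :=
  match s with
  | Euclidean => idfun
  | Hermitian => Num.conj
  end.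

(* An element of the exterior algebra is the family of its coordinates on the
   basis e_S = e_{i1} /\ ... /\ e_{ip}, where S = {i1 < ... < ip} and e is the
   basis [vbasis {:X}] of X, which need not be orthonormal.  See [wedgeA],
   [wedge1l], [wedge1r], [ext_vec_sq], [wedge_seq_blade] and
   [exterior_sum_blade] for the algebra. *)
Definition exterior (K : fieldType) (X : vectType K) : Type :=
  {ffun {set 'I_(\dim {:X})} -> K^o}.
HB.instance Definition _ (K : fieldType) (X : vectType K) :=
  Vector.on (exterior X).

Section ExteriorAlgebra.
Variables (K : fieldType) (X : vectType K).
Local Notation n := (\dim {:X}).
Local Notation e := (vbasis {:X}).
Implicit Types (x y v : X) (L M N : exterior X) (S T U : {set 'I_n}).

Definition inversions S T : nat :=
  #|[set p : 'I_n * 'I_n | [&& p.1 \in S, p.2 \in T & (p.2 < p.1)%N]]|.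

(* For disjoint S and T, e_S /\ e_T = (-1)^(inversions S T) e_(S u T). *)
Definition wedge M N : exterior X :=
  [ffun U : {set 'I_n} => \sum_(S in powerset U)
     (-1) ^+ inversions S (U :\: S) * (M S * N (U :\: S))].

Definition ext_one : exterior X := [ffun S : {set 'I_n} => (S == set0)%:R].

Definition ext_vec x : exterior X :=
  [ffun S : {set 'I_n} => \sum_(i | S == [set i]) coord e i x].

Definition wedge_seq (xs : seq X) : exterior X :=
  foldr (fun x M => wedge (ext_vec x) M) ext_one xs.

(* The basis vectors indexed by S, by increasing index: [wedge_seq (blade S)]
   is e_S. *)
Definition blade S : seq X := [seq e`_i | i : 'I_n <- enum S].

Definition grade_part p M : exterior X :=
  [ffun S : {set 'I_n} => if #|S| == p then M S else 0].

(* The default values (the dimension and 0) are only reached when M = 0. *)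
Definition bottom_grade M : nat :=
  \big[minn/n]_(p < n.+1 | grade_part p M != 0) p.
Definition top_grade M : nat := \max_(p < n.+1 | grade_part p M != 0) p.

Definition inner_space M : {vspace X} :=
  lker (linfun (fun v => wedge (ext_vec v) M)).

Definition inner_grade M : nat := \dim (inner_space M).

Definition minor (xs : seq X) S : K :=
  if size xs == #|S| then
    \det (\matrix_(i < size xs, j < size xs)
            [seq coord e k xs`_i | k <- enum S]`_j)
  else 0.

End ExteriorAlgebra.

Section InnerProduct.
Variables (K : numFieldType) (theta : involutive_rmorphism K).
Variables (X : vectType K) (ip : {dot X for theta}).
Local Notation n := (\dim {:X}).
Implicit Types (x y v : X) (L M N Q : exterior X) (S T : {set 'I_n}).

(* [{dot X for theta}] is linear in its first argument and theta-linear in the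
   second; the convention used here is the opposite one. *)
Definition inner x y : K := ip y x.

Definition gram_det (xs ys : seq X) : K :=
  if size xs == size ys then
    \det (\matrix_(i < size xs, j < size xs) inner xs`_i ys`_j)
  else 0.

(* Gram determinants on the basis e_S, extended sesquilinearly;
   [ext_inner_wedge_seq] gives the formula for arbitrary vectors. *)
Definition ext_inner M N : K :=
  \sum_S \sum_T theta (M S) * gram_det (blade S) (blade T) * N T.

(* Existence and uniqueness: [contractP] and [contract_unique]. *)
Definition contract M N : exterior X :=
  classical_sets.xget 0
    (fun Q => forall L, ext_inner L Q = ext_inner (wedge M L) N).

(* {v | v _| M = 0}.  As v _| M is theta-linear in v, its coordinates are
   conjugated to obtain the kernel of a linear map; see [mem_left_kernel]. *)
Definition left_kernel M : {vspace X} :=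
  lker (linfun (fun v =>
    [ffun S => theta (contract (ext_vec v) M S)] : exterior X)).

Definition outer_space M : {vspace X} := orthov ip (left_kernel M).

Definition outer_grade M : nat := \dim (outer_space M).

End InnerProduct.

Section EnumSet.
Variable n : nat.
Implicit Types (S : {set 'I_n}) (i : 'I_n).

Lemma index_enum_set S i : i \in S ->
  index i (enum S) = #|[set j : 'I_n in S | (j < i)%N]|.
Proof.
move=> iS.
have sS : sorted ltn (map val (enum S)).
  rewrite -[enum _](eq_filter (mem_enum _)) -(eq_filter (mem_map val_inj _)) -filter_map.
  by rewrite (sorted_filter ltn_trans) // unlock val_ord_enum iota_ltn_sorted.
have iS' : i \in enum S by rewrite mem_enum.
rewrite cardE (_ : enum _ = [seq j : 'I_n <- enum S | (j < i)%N]); last first.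
  rewrite /enum_mem -filter_predI; apply: eq_filter => j.
  by rewrite !inE andbC.
case/splitPr: iS' sS => s1 s2; rewrite map_cat /= => sS.
have [ss1 ss2] : all (fun j : 'I_n => (j < i)%N) s1 /\ all (fun j : 'I_n => (i < j)%N) s2.
  move: sS; rewrite (sorted_pairwise ltn_trans) pairwise_cat /= => /and3P[H _ /andP[H2 _]].
  split; apply/allP => j js.
    by move/allrelP: H => /(_ (val j) (val i)) H; apply: H; [apply: map_f | apply: mem_head].
  by move/allP: H2; apply; rewrite map_f.
rewrite filter_cat /= ltnn size_cat (all_filterP ss1).
have -> : [seq j : 'I_n <- s2 | (j < i)%N] = [::].
  apply/eqP; rewrite -(negbK (_ == _)) -has_filter -all_predC.
  by apply: sub_all ss2 => j /= ij; rewrite -leqNgt ltnW.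
rewrite addn0 index_cat /= eqxx addn0 ifN //.
by apply/negP => /(allP ss1); rewrite ltnn.
Qed.

Lemma enum_setD1 S i : enum (S :\ i) = rem i (enum S).
Proof.
rewrite rem_filter ?enum_uniq // /enum_mem -filter_predI; apply: eq_filter => j.
by rewrite !inE.
Qed.

Lemma nth_enum_setD1 i0 S j k : (j < #|S|)%N ->
  nth i0 (enum (S :\ nth i0 (enum S) j)) k = nth i0 (enum S) (bump j k).
Proof.
move=> jS; rewrite enum_setD1 remE index_uniq ?enum_uniq -?cardE // nth_cat.
rewrite size_take -cardE jS /bump; case: (leqP j k) => jk.
  by rewrite add1n nth_drop addSn subnKC.
by rewrite add0n nth_take.
Qed.

Lemma card_pos_set S p : #|S| = p.+1 -> exists i, i \in S.
Proof. by move=> h; apply/card_gt0P; rewrite h. Qed.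
End EnumSet.

Section CauchyBinet.
Variable K : comNzRingType.

Lemma det_mulmx_ffun p n (A : 'M[K]_(p, n)) (B : 'M[K]_(n, p)) :
  \det (A *m B) = \sum_(f : {ffun 'I_p -> 'I_n})
     (\prod_i A i (f i)) * \det (\matrix_(i, j) B (f i) j).
Proof.
rewrite /determinant.
transitivity (\sum_(s : 'S_p) \sum_(f : {ffun 'I_p -> 'I_n})
    (-1) ^+ s * (\prod_i A i (f i) * \prod_i B (f i) (s i))).
  apply: eq_bigr => s _; rewrite -big_distrr /=; congr (_ * _).
  under eq_bigr => i _ do rewrite mxE.
  rewrite bigA_distr_bigA /=; apply: eq_bigr => f _.
  by rewrite big_split.
rewrite exchange_big /=; apply: eq_bigr => f _.
rewrite big_distrr /=; apply: eq_bigr => s _.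
by rewrite mulrCA; congr (_ * (_ * _)); apply: eq_bigr => i _; rewrite mxE.
Qed.

Lemma cauchy_binet p n (A : 'M[K]_(p, n)) (B : 'M[K]_(n, p)) :
  \det (A *m B) = \sum_(S : {set 'I_n} | #|S| == p)
    \det (\matrix_(i < p, j < p) [seq A i k | k <- enum S]`_j) *
    \det (\matrix_(i < p, j < p) [seq B k j | k <- enum S]`_i).
Proof.
rewrite det_mulmx_ffun (bigID (fun f : {ffun _} => injectiveb f)) /= [X in _ + X]big1 ?addr0; last first.
  move=> f /injectivePn[i [j ij fij]].
  by rewrite (determinant_alternate ij) ?mulr0 // => k; rewrite !mxE fij.
rewrite (partition_big (fun f : {ffun 'I_p -> 'I_n} => f @: 'I_p) (fun S => #|S| == p)) /=; last first.
  by move=> f /injectiveP fI; rewrite card_imset // card_ord.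
apply: eq_bigr => S /eqP hS.
pose g (i : 'I_p) : 'I_n := enum_val (cast_ord (esym hS) i).
have gI : injective g by move=> i j /enum_val_inj /cast_ord_inj.
have gE i0 (i : 'I_p) : nth i0 (enum S) i = g i by rewrite /g (enum_val_nth i0).
have gS : g @: 'I_p = S.
  apply/eqP; rewrite eqEcard card_imset // card_ord hS leqnn andbT.
  by apply/subsetP => _ /imsetP[i _ ->]; apply: enum_valP.
have -> : \matrix_(i < p, j < p) [seq A i k | k <- enum S]`_j = \matrix_(i, j) A i (g j).
  by apply/matrixP=> i j; rewrite !mxE (nth_map (g i)) ?gE // -cardE hS.
have -> : \matrix_(i < p, j < p) [seq B k j | k <- enum S]`_i = \matrix_(i, j) B (g i) j.
  by apply/matrixP=> i j; rewrite !mxE (nth_map (g i)) ?gE // -cardE hS.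
pose h (s : 'S_p) : {ffun 'I_p -> 'I_n} := [ffun i => g (s i)].
have hI : injective h.
  by move=> s t /ffunP st; apply/permP=> i; have := st i; rewrite !ffunE => /gI.
rewrite (eq_bigl (mem (h @: 'S_p))) => [|f]; last first.
  apply/andP/imsetP => [[/injectiveP fI /eqP fS]|[s _ ->]]; last first.
    split; first by apply/injectiveP => i j; rewrite !ffunE => /gI /perm_inj.
    rewrite -gS eqEcard !card_imset //; last first.
      by move=> i j; rewrite !ffunE => /gI /perm_inj.
    rewrite leqnn andbT; apply/subsetP => _ /imsetP[i _ ->].
    by rewrite ffunE imset_f.
  have ex i : exists j, g j == f i.
    have : f i \in g @: 'I_p by rewrite gS -fS imset_f.
    by case/imsetP => j _ ->; exists j.
  pose s0 i := xchoose (ex i).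
  have s0E i : g (s0 i) = f i by apply/eqP/(xchooseP (ex i)).
  have s0I : injective s0 by move=> i j sij; apply: fI; rewrite -!s0E sij.
  exists (perm s0I) => //; apply/ffunP=> i; rewrite ffunE permE; exact/esym/s0E.
rewrite big_imset /=; last by move=> s t _ _; apply: hI.
rewrite [X in X * _]/determinant big_distrl /=.
rewrite (eq_bigl predT) => [|s]; last by rewrite inE.
apply: eq_bigr => s _.
have -> : \matrix_(i, j) B (h s i) j = row_perm s (\matrix_(i, j) B (g i) j).
  by apply/matrixP=> i j; rewrite !mxE ffunE.
rewrite row_permE det_mulmx det_perm.
under eq_bigr => i _ do rewrite ffunE.
under [in RHS]eq_bigr => i _ do rewrite mxE.
by rewrite mulrCA mulrA.
Qed.

End CauchyBinet.

Section ExteriorTheory.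
Variables (K : fieldType) (X : vectType K).
Local Notation n := (\dim {:X}).
Local Notation e := (vbasis {:X}).
Implicit Types (x y v : X) (L M N : exterior X) (S T U : {set 'I_n}).

Lemma exteriorP M N : (forall S, M S = N S) -> M = N.
Proof. by move=> MN; apply/(@ffunP {set 'I_n} (fun=> K^o) M N). Qed.

Lemma exteriorDE M N S : (M + N) S = M S + N S.
Proof. exact: ffunE. Qed.

Lemma exteriorZE a M S : (a *: M) S = a * M S.
Proof. exact: ffunE. Qed.

Lemma wedge_linearl N : linear (fun M => wedge M N).
Proof.
move=> a L M /=; apply: exteriorP => U; rewrite exteriorDE exteriorZE !ffunE mulr_sumr -big_split /=.
apply: eq_bigr => S _; rewrite exteriorDE exteriorZE !mulrDl mulrDr; congr (_ + _).
by rewrite -!mulrA mulrCA.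
Qed.

Lemma wedge_linearr M : linear (wedge M).
Proof.
move=> a L N /=; apply: exteriorP => U; rewrite exteriorDE exteriorZE !ffunE mulr_sumr -big_split /=.
apply: eq_bigr => S _; rewrite exteriorDE exteriorZE !mulrDr; congr (_ + _).
by rewrite [a * L _]mulrC !mulrA mulrC !mulrA.
Qed.

Lemma inversionsUl S T U : [disjoint S & T] ->
  inversions (S :|: T) U = (inversions S U + inversions T U)%N.
Proof.
move=> dST; rewrite /inversions; set A := finset _; set B := finset _; set C := finset _.
have -> : A = B :|: C.
  by apply/setP=> p; rewrite !inE; do !case: (_ \in _); case: (_ < _)%N.
apply/eqP; rewrite (leq_card_setU _ _) -setI_eq0; apply/eqP/setP=> p; rewrite !inE.
case: (boolP (p.1 \in S)) => //= pS.
by rewrite (disjointFr dST pS) andbF.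
Qed.

Lemma inversionsUr S T U : [disjoint T & U] ->
  inversions S (T :|: U) = (inversions S T + inversions S U)%N.
Proof.
move=> dTU; rewrite /inversions; set A := finset _; set B := finset _; set C := finset _.
have -> : A = B :|: C.
  by apply/setP=> p; rewrite !inE; do !case: (_ \in _); case: (_ < _)%N.
apply/eqP; rewrite (leq_card_setU _ _) -setI_eq0; apply/eqP/setP=> p; rewrite !inE.
case: (boolP (p.2 \in T)) => pT; rewrite ?andbF //=.
by rewrite (disjointFr dTU pT) /= !andbF.
Qed.

Lemma wedgeA L M N : wedge L (wedge M N) = wedge (wedge L M) N.
Proof.
apply: exteriorP => U; rewrite !ffunE; apply/esym.
transitivity (\sum_(S in powerset U) \sum_(T in powerset S)
   (-1) ^+ (inversions S (U :\: S) + inversions T (S :\: T)) *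
     (L T * M (S :\: T) * N (U :\: S))).
  apply: eq_bigr => S _; rewrite ffunE big_distrl /= big_distrr /=.
  by apply: eq_bigr => T _; rewrite exprD -!mulrA.
rewrite (exchange_big_dep (mem (powerset U))) /=; last first.
  by move=> S T; rewrite !inE => SU TS; apply: subset_trans SU.
apply: eq_bigr => T; rewrite inE => TU.
rewrite ffunE !big_distrr /=.
rewrite (reindex_onto (fun V => T :|: V) (fun S => S :\: T)) /=; last first.
  move=> S; rewrite !inE => /andP[_ TS]; apply/setP=> i; rewrite !inE.
  by case: (boolP (i \in T)) => //= /(subsetP TS).
apply: eq_big => [V|V].
  rewrite !inE subUset TU subsetUl andbT /= subsetD; congr (_ && _).
  rewrite setDUl setDv set0U; apply/eqP/idP => [/setDidPl//|dVT].
  exact/setDidPl.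
rewrite !inE => /andP[/andP[VU _] /eqP VT].
have dTV : [disjoint T & V] by rewrite disjoint_sym; apply/setDidPl; rewrite -{2}VT setDUl setDv set0U.
rewrite VT; have -> : U :\: (T :|: V) = U :\: T :\: V by rewrite setDDl.
rewrite (inversionsUl _ dTV).
have -> : inversions T (U :\: T) =
   (inversions T V + inversions T (U :\: T :\: V))%N.
  rewrite -inversionsUr; last first.
    rewrite -setI_eq0; apply/eqP/setP=> i; rewrite !inE; by case: (i \in V).
  congr inversions; apply/setP=> i; rewrite !inE.
  case: (boolP (i \in V)) => //= iV; move: (VU); rewrite subUset => /andP[_ /subsetP->] //.
  by rewrite (disjointFl dTV iV).
rewrite !exprD -!mulrA; set a := _ ^+ _; set b := _ ^+ _; set c := _ ^+ _.
ring.
Qed.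

Lemma wedge_vecE x M U : wedge (ext_vec x) M U =
  \sum_(i in U) (-1) ^+ index i (enum U) * (coord e i x * M (U :\ i)).
Proof.
rewrite ffunE.
under eq_bigr => S _ do rewrite ffunE big_distrl big_distrr /=.
rewrite (exchange_big_dep predT) //= [RHS]big_mkcond /=; apply: eq_bigr => i _.
rewrite (eq_bigl (fun S => (S == [set i]) && (i \in U))); last first.
  by move=> S; rewrite inE andbC; case: eqP => //= ->; rewrite sub1set.
case: (boolP (i \in U)) => iU; last by rewrite big_pred0 // => S; rewrite andbF.
rewrite (eq_bigl (pred1 [set i])); last by move=> S; rewrite andbT.
rewrite big_pred1_eq; congr (_ ^+ _ * _).
rewrite index_enum_set // /inversions -(@card_imset _ _ (pair i) (mem [set j : 'I_n in U | (j < i)%N])); last by move=> j k [].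
apply: eq_card => p; rewrite !inE; apply/and3P/imsetP => [[/eqP p1 /andP[_ pU] lt]|[j]].
  exists p.2; first by rewrite inE pU -p1.
  by rewrite -p1; case: (p).
rewrite inE => /andP[jU lt] -> /=; split=> //; rewrite jU andbT.
by apply: contraTneq lt => ->; rewrite ltnn.
Qed.

Lemma wedge_seqE xs S : wedge_seq xs S = minor xs S.
Proof.
elim: xs S => [|x xs IH] S.
  rewrite /minor /= ffunE [0%N == _]eq_sym cards_eq0; case: ifP => // _; exact/esym/det_mx00.
rewrite /= wedge_vecE /minor /=.
under eq_bigr => i _ do rewrite IH.
case: (eqVneq (size xs).+1 #|S|) => hS; last first.
  apply: big1 => i iS; rewrite /minor ifN ?mulr0 //.
  by apply: contra hS => /eqP ->; rewrite (cardsD1 i S) iS.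
have [i0 i0S] := card_pos_set (esym hS).
rewrite -big_enum (big_nth i0) -cardE -hS big_mkord.
rewrite (expand_det_row _ ord0); apply: eq_bigr => j _.
have jS : (j < #|S|)%N by rewrite -hS.
rewrite index_uniq ?enum_uniq -?cardE // /cofactor mxE /=.
rewrite (nth_map i0) -?cardE // mulrCA; congr (_ * (_ * _)).
have hD : size xs = #|S :\ nth i0 (enum S) j|.
  have h2 : #|S| = #|S :\ nth i0 (enum S) j|.+1.
    by rewrite (cardsD1 (nth i0 (enum S) j) S) -mem_enum mem_nth -?cardE.
  by apply: succn_inj; rewrite -h2.
rewrite /minor ifT; last exact/eqP.
congr (\det _); apply/matrixP=> i k; rewrite !mxE /=.
rewrite !(nth_map i0) -?cardE -?hD ?nth_enum_setD1 //.
by rewrite -hS; apply: (ltn_ord (lift j k)).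
Qed.

Lemma inversions0l T : inversions set0 T = 0%N.
Proof. by apply: eq_card0 => p; rewrite !inE. Qed.

Lemma inversions0r S : inversions S set0 = 0%N.
Proof. by apply: eq_card0 => p; rewrite !inE andbF. Qed.

Lemma wedge1l M : wedge (ext_one X) M = M.
Proof.
apply: exteriorP => U; rewrite ffunE (bigD1 set0) ?inE ?sub0set //= big1 ?addr0.
  by rewrite inversions0l ffunE eqxx setD0 !mul1r.
by move=> S /andP[_ /negbTE S0]; rewrite ffunE S0 mul0r mulr0.
Qed.

Lemma wedge1r M : wedge M (ext_one X) = M.
Proof.
apply: exteriorP => U; rewrite ffunE (bigD1 U) ?inE //= big1 ?addr0.
  by rewrite setDv inversions0r ffunE eqxx mulr1 mul1r.
move=> S; rewrite inE => /andP[SU nSU]; rewrite ffunE setD_eq0.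
case: (boolP (U \subset S)) => US; last by rewrite !mulr0.
by rewrite eqEsubset SU US in nSU.
Qed.

Lemma ext_vec_linear : linear (@ext_vec K X).
Proof.
move=> a x y; apply: exteriorP => S; rewrite exteriorDE exteriorZE !ffunE.
rewrite mulr_sumr -big_split /=; apply: eq_bigr => i _.
by rewrite linearP.
Qed.

Lemma ext_vec_sq x : wedge (ext_vec x) (ext_vec x) = 0.
Proof.
have -> : wedge (ext_vec x) (ext_vec x) = wedge_seq [:: x; x] by rewrite /= wedge1r.
apply: exteriorP => S; rewrite wedge_seqE /minor ffunE; case: ifP => //= _.
rewrite (@determinant_alternate _ _ _ ord0 ord_max) // => j.
by rewrite !mxE.
Qed.

Lemma nth_blade (i0 : 'I_n) S k : (k < #|S|)%N -> (blade S)`_k = e`_(nth i0 (enum S) k).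
Proof. by move=> kS; rewrite (nth_map i0) // -cardE. Qed.

Lemma size_blade S : size (blade S) = #|S|.
Proof. by rewrite size_map -cardE. Qed.

Lemma det_delta_blade p (S T : {set 'I_n}) (A : 'M[K]_p) : #|S| = p -> #|T| = p ->
  (forall (i0 : 'I_n) (i j : 'I_p), A i j = (nth i0 (enum S) i == nth i0 (enum T) j)%:R) ->
  \det A = (S == T)%:R.
Proof.
move=> hS hT hA; case: eqP => [eST|nST].
  have -> : A = 1%:M; last by rewrite det1.
  apply/matrixP=> i j; have [i0 _] : exists i0 : 'I_n, i0 \in S.
    by apply/card_gt0P; rewrite hS; case: (i) => k; case: (p).
  by rewrite (hA i0) mxE eST nth_uniq ?enum_uniq -?cardE ?hT.
have [k kS kT] : exists2 k, k \in S & k \notin T.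
  apply/subsetPn; apply/negP => ST; apply: nST; apply/eqP.
  by rewrite eqEcard ST hS hT leqnn.
have ik : (index k (enum S) < p)%N by rewrite -hS cardE index_mem mem_enum.
rewrite (expand_det_row _ (Ordinal ik)) big1 // => j _.
rewrite (hA k) /= nth_index ?mem_enum //.
case: eqP => [kE|]; last by rewrite mul0r.
by case/negP: kT; rewrite -mem_enum kE mem_nth // -cardE hT.
Qed.

Lemma wedge_seq_blade S T : wedge_seq (blade S) T = (T == S)%:R.
Proof.
rewrite wedge_seqE /minor size_blade; case: eqP => [hST|]; last first.
  by move=> hST; case: eqP => // eST; rewrite eST in hST.
rewrite eq_sym; apply: det_delta_blade => // i0 i j.
rewrite mxE (nth_map i0) -?cardE -?hST // (nth_blade i0) //.
by rewrite coord_free ?(basis_free (vbasisP _)).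
Qed.

Lemma exterior_sum_blade M : M = \sum_S M S *: wedge_seq (blade S).
Proof.
apply: exteriorP => T.
rewrite (_ : (\sum_S M S *: wedge_seq (blade S) : exterior X) T =
             \sum_S (M S *: wedge_seq (blade S) : exterior X) T); last first.
  by apply: (big_morph (fun N : exterior X => N T)) => [L N|]; rewrite ffunE.
rewrite (bigD1 T) //= big1 => [|S ST].
  by rewrite exteriorZE wedge_seq_blade eqxx mulr1 addr0.
by rewrite exteriorZE wedge_seq_blade eq_sym (negbTE ST) mulr0.
Qed.

Lemma mem_inner_space v M : (v \in inner_space M) = (wedge (ext_vec v) M == 0).
Proof.
pose F v := wedge (ext_vec v) M.
have FL : linear F by move=> a x y; rewrite /F ext_vec_linear wedge_linearl.
pose F_lin := GRing.isLinear.Build _ _ _ _ F FL.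
pose F0 : {linear X -> exterior X} := HB.pack F F_lin.
by rewrite memv_ker -[linfun _]/(linfun F0) lfunE.
Qed.

Lemma grade_part_out p M : (n < p)%N -> grade_part p M = 0.
Proof.
move=> np; apply: exteriorP => S; rewrite !ffunE; case: eqP => // Sp.
by have := max_card (mem S); rewrite card_ord Sp leqNgt np.
Qed.

Lemma exterior_neq0_grade M : M != 0 -> exists p : 'I_n.+1, grade_part p M != 0.
Proof.
move=> M0; apply/existsP; apply: contraNT M0 => /existsPn H; apply/eqP/exteriorP => S.
have Sn : (#|S| < n.+1)%N by rewrite ltnS -[n in (_ <= n)%N]card_ord max_card.
have /negPn/eqP := H (Ordinal Sn).
by move=> /(congr1 (fun N : exterior X => N S)); rewrite !ffunE eqxx.
Qed.

Lemma bottom_gradeP M : M != 0 -> grade_part (bottom_grade M) M != 0 /\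
  forall p, grade_part p M != 0 -> (bottom_grade M <= p)%N.
Proof.
move=> /exterior_neq0_grade [q qM].
have lb p : grade_part p M != 0 -> (bottom_grade M <= p)%N.
  move=> pM; have pn : (p < n.+1)%N.
    by rewrite ltnS leqNgt; apply: contra pM => /grade_part_out ->.
  rewrite /bottom_grade; move: (mem_index_enum (Ordinal pn)).
  elim: (index_enum _) => // i r IH; rewrite big_cons inE => /predU1P[<-|/IH h].
    by rewrite pM geq_minl.
  by case: ifP => _ //; apply: leq_trans (geq_minr _ _) h.
split=> //.
have : bottom_grade M = n \/ grade_part (bottom_grade M) M != 0.
  rewrite /bottom_grade; apply: (big_ind (fun r => r = n \/ grade_part r M != 0)).
  - by left.
  - by move=> x y hx hy; rewrite /minn; case: ifP.
  - by move=> i iM; right.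
case=> // bn; have := lb _ qM; rewrite bn => nq.
by have -> : n = q by apply/eqP; rewrite eqn_leq nq -ltnS ltn_ord.
Qed.

Lemma top_gradeP M : M != 0 -> grade_part (top_grade M) M != 0 /\
  forall p, grade_part p M != 0 -> (p <= top_grade M)%N.
Proof.
move=> /exterior_neq0_grade [q qM]; split=> [|p pM].
  by rewrite /top_grade (bigop.bigmax_eq_arg q) //; case: arg_maxnP.
have pn : (p < n.+1)%N.
  by rewrite ltnS leqNgt; apply: contra pM => /grade_part_out ->.
exact: (leq_bigmax_cond (Ordinal pn)).
Qed.

End ExteriorTheory.

Section InnerProductTheory.
Variables (K : numFieldType) (theta : involutive_rmorphism K).
Variables (X : vectType K) (ip : {dot X for theta}).
Local Notation n := (\dim {:X}).
Local Notation e := (vbasis {:X}).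
Local Notation inner := (inner ip).
Local Notation gram_det := (gram_det ip).
Local Notation ext_inner := (ext_inner ip).
Local Notation contract := (contract ip).
Local Notation left_kernel := (left_kernel ip).
Local Notation outer_space := (outer_space ip).
Implicit Types (x y v : X) (L M N Q : exterior X) (S T U : {set 'I_n}).

Lemma ext_inner_linearr M : linear_for *%R (ext_inner M).
Proof.
move=> a N Q; rewrite /Defs.ext_inner mulr_sumr -big_split /=; apply: eq_bigr => S _.
rewrite mulr_sumr -big_split /=; apply: eq_bigr => T _.
by rewrite exteriorDE exteriorZE mulrDr mulrCA.
Qed.

Lemma ext_inner_semilinearl N a L M :
  ext_inner (a *: L + M) N = theta a * ext_inner L N + ext_inner M N.
Proof.
rewrite /Defs.ext_inner mulr_sumr -big_split /=; apply: eq_bigr => S _.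
rewrite mulr_sumr -big_split /=; apply: eq_bigr => T _.
by rewrite exteriorDE exteriorZE rmorphD rmorphM !mulrDl -!mulrA.
Qed.

Let gramM : 'M[K]_n := \matrix_(k < n, l < n) inner e`_k e`_l.

Lemma inner_coord x y :
  inner x y = \sum_(k < n) \sum_(l < n) theta (coord e k x) * inner e`_k e`_l * coord e l y.
Proof.
rewrite {1}/Defs.inner {1}(coord_vbasis (memvf y)) {1}(coord_vbasis (memvf x)).
rewrite linear_sumr; apply: eq_bigr => k _; rewrite linear_sumlz; apply: eq_bigr => l _.
by rewrite linearZl_LR linearZr_LR /= mulrC.
Qed.

Lemma ext_inner_wedge_seq xs ys :
  ext_inner (wedge_seq xs) (wedge_seq ys) = gram_det xs ys.
Proof.
rewrite /Defs.ext_inner /Defs.gram_det; under eq_bigr => S _ do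
  under eq_bigr => T _ do rewrite !wedge_seqE /minor !size_blade.
case: eqP => [hxy|nxy]; last first.
  rewrite big1 // => S _; rewrite big1 // => T _.
  case: eqP => hx; last by rewrite rmorph0 !mul0r.
  case: eqP => hST; last by rewrite mulr0 mul0r.
  by case: eqP => hy; [case: nxy; rewrite hx hST | rewrite mulr0].
pose p := size xs.
pose A : 'M[K]_(p, n) := \matrix_(i, k) theta (coord e k xs`_i).
pose B : 'M[K]_(n, p) := \matrix_(k, j) coord e k ys`_j.
have -> : \matrix_(i < size xs, j < size xs) inner xs`_i ys`_j = A *m (gramM *m B).
  apply/matrixP=> i j; rewrite !mxE inner_coord; apply: eq_bigr => k _.
  rewrite !mxE big_distrr /=; apply: eq_bigr => l _; by rewrite !mxE mulrA.
rewrite cauchy_binet [RHS]big_mkcond /=; apply: eq_bigr => S _.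
case: (eqVneq #|S| (size xs)) => hS; last first.
  by rewrite big1 // => T _; rewrite rmorph0 !mul0r.
pose C : 'M[K]_(p, n) := \matrix_(i, l) [seq gramM k l | k <- enum S]`_i.
have -> : \matrix_(i < size xs, j < size xs) [seq (gramM *m B) k j | k <- enum S]`_i = C *m B.
  apply/matrixP=> i j; have [i0 _] : exists i0 : 'I_n, i0 \in S.
    by apply/card_gt0P; rewrite hS; case: (i) => k; case: (size xs).
  rewrite !mxE (nth_map i0) -?cardE ?hS // mxE; apply: eq_bigr => l _.
  by rewrite !mxE (nth_map i0) -?cardE ?hS // mxE.
rewrite cauchy_binet big_distrr [RHS]big_mkcond /=; apply: eq_bigr => T _.
rewrite -hxy hS.
case: (eqVneq #|T| (size xs)) => hT; last by rewrite !mulr0.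
rewrite -mulrA; congr (_ * (_ * _)).
- rewrite -det_map_mx; congr (\det _); apply/matrixP=> i j.
  rewrite !mxE !(nth_map (enum_val (cast_ord (esym hS) i))) -?cardE ?hS //.
  by rewrite mxE.
- congr (\det _); apply/matrixP=> i j.
  pose i0 : 'I_n := enum_val (cast_ord (esym hS) i).
  rewrite !mxE (nth_map i0) -?cardE ?hT // mxE.
  by rewrite !(nth_map i0) -?cardE ?hS ?hT //= mxE.
- rewrite -det_tr; congr (\det _); apply/matrixP=> i j.
  pose i0 : 'I_n := enum_val (cast_ord (esym hS) i).
  by rewrite !mxE !(nth_map i0) -?cardE ?hT // mxE.
Qed.

Lemma dual_basis : exists f : 'I_n -> X, forall i k : 'I_n, inner (f i) e`_k = (i == k)%:R.
Proof.
pose phi_fun v : 'rV[K]_n := \row_(k < n) ip v e`_k.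
have phiL : linear phi_fun.
  by move=> a x y; apply/rowP=> k; rewrite !mxE linearPl.
pose phi_lin := GRing.isLinear.Build _ _ _ _ phi_fun phiL.
pose phi0 : {linear X -> 'rV[K]_n} := HB.pack phi_fun phi_lin.
pose phi := linfun phi0.
have ker0 : lker phi = 0%VS.
  apply/eqP; rewrite -subv0; apply/subvP=> v; rewrite memv_ker lfunE memv0 /=.
  move=> /eqP /rowP v0; apply/negPn/negP => /(@neq0_dnorm_gt0 _ _ _ ip) /=.
  rewrite {2}(coord_vbasis (memvf v)) linear_sumr big1 ?ltxx // => k _.
  by rewrite linearZr_LR /=; have := v0 k; rewrite !mxE => ->; rewrite mulr0.
have full : limg phi = fullv.
  apply/eqP; rewrite eqEdim subvf /= dimvf /dim /= mul1n.
  by rewrite -[X in (X <= _)%N](limg_ker_dim phi fullv) ker0 capv0 dimv0.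
have ex i : exists v, phi v = delta_mx 0 i.
  have : delta_mx 0 i \in limg phi by rewrite full memvf.
  by case/memv_imgP => v _ ->; exists v.
have [f fE] := @fin_all_exists _ _ (fun i v => phi v = delta_mx 0 i) ex.
exists f => i k; have := congr1 (fun r : 'rV_n => r 0 k) (fE i).
rewrite lfunE /= !mxE eqxx /= => h.
transitivity (theta (ip (f i) e`_k)); first by rewrite /Defs.inner hermC expr0 mul1r.
by rewrite h rmorph_nat eq_sym.
Qed.

Lemma ext_inner_nondeg N : (forall L, ext_inner L N = 0) -> N = 0.
Proof.
move=> N0; have [f fE] := dual_basis; apply: exteriorP => T; rewrite [RHS]ffunE.
rewrite -(N0 (wedge_seq [seq f i | i <- enum T])).
rewrite {2}(exterior_sum_blade N).
pose F := ext_inner (wedge_seq [seq f i | i <- enum T]).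
have -> : ext_inner (wedge_seq [seq f i | i <- enum T])
     (\sum_S N S *: wedge_seq (blade S)) =
     \sum_S N S * gram_det [seq f i | i <- enum T] (blade S).
  pose F_lin := GRing.isLinear.Build _ _ _ _ F (ext_inner_linearr _).
  pose F0 : {linear exterior X -> K^o} := HB.pack F F_lin.
  rewrite -/F -[F]/(F0 : _ -> _) linear_sum; apply: eq_bigr => S _.
  by rewrite linearZ /= /F ext_inner_wedge_seq.
have gE S : gram_det [seq f i | i <- enum T] (blade S) = (T == S)%:R.
  rewrite /Defs.gram_det size_map -cardE size_blade; case: eqP => hTS; last first.
    by case: eqP => // TS; rewrite TS in hTS.
  apply: det_delta_blade => // i0 i j.
  by rewrite mxE (nth_map i0) -?cardE // (nth_blade i0) -?hTS // fE.
rewrite (bigD1 T) //= big1 ?addr0 => [|S ST]; rewrite gE ?eqxx ?mulr1 //.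
by rewrite eq_sym (negbTE ST) mulr0.
Qed.

Lemma contract_ex M N : exists Q, forall L, ext_inner L Q = ext_inner (wedge M L) N.
Proof.
pose G_fun Q : exterior X := [ffun S : {set 'I_n} => ext_inner (wedge_seq (blade S)) Q].
have GL : linear G_fun.
  by move=> a L Q; apply: exteriorP => S; rewrite exteriorDE exteriorZE !ffunE ext_inner_linearr.
pose G_lin := GRing.isLinear.Build _ _ _ _ G_fun GL.
pose G0 : {linear exterior X -> exterior X} := HB.pack G_fun G_lin.
pose G := linfun G0.
have expand L P : ext_inner L P = \sum_S theta (L S) * ext_inner (wedge_seq (blade S)) P.
  rewrite {1}(exterior_sum_blade L).
  elim/big_rec2: _ => [|S y x _ <-]; last exact: ext_inner_semilinearl.
  by have := ext_inner_semilinearl P (-1) 0 0; rewrite scaler0 addr0 rmorphN1 mulN1r addNr.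
have ker0 : lker G = 0%VS.
  apply/eqP; rewrite -subv0; apply/subvP=> Q; rewrite memv_ker lfunE memv0 /=.
  move=> /eqP GQ; apply/eqP/ext_inner_nondeg => L; rewrite expand big1 // => S _.
  have := congr1 (fun M : exterior X => M S) GQ.
  by rewrite !ffunE => ->; rewrite mulr0.
pose tgt : exterior X := [ffun S : {set 'I_n} => ext_inner (wedge M (wedge_seq (blade S))) N].
exists ((G^-1)%VF tgt) => L; rewrite expand.
have GQ : G ((G^-1)%VF tgt) = tgt by rewrite lker0_lfunVK //; exact/eqP.
set Q := (G^-1)%VF tgt in GQ *.
have QE S : ext_inner (wedge_seq (blade S)) Q = ext_inner (wedge M (wedge_seq (blade S))) N.
  have := congr1 (fun M : exterior X => M S) GQ.
  by rewrite lfunE !ffunE.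
under eq_bigr => S _ do rewrite QE.
rewrite {2}(exterior_sum_blade L).
elim/big_rec2: _ => [|S y x _ ->].
  have -> : wedge M 0 = 0.
    by have := wedge_linearr M (-1) 0 0; rewrite scaler0 addr0 scaleN1r addNr.
  by have := ext_inner_semilinearl N (-1) 0 0; rewrite scaler0 addr0 rmorphN1 mulN1r addNr => ->.
by rewrite wedge_linearr ext_inner_semilinearl.
Qed.

Lemma contractP M N L : ext_inner L (contract M N) = ext_inner (wedge M L) N.
Proof. exact: (classical_sets.xgetPex _ (contract_ex M N)). Qed.

Lemma contract_unique M N Q :
  (forall L, ext_inner L Q = ext_inner (wedge M L) N) -> Q = contract M N.
Proof.
move=> QE; apply/eqP; rewrite -subr_eq0; apply/eqP/ext_inner_nondeg => L.
rewrite addrC -scaleN1r ext_inner_linearr QE contractP mulN1r; exact: addNr.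
Qed.

Lemma mem_left_kernel v M : (v \in left_kernel M) = (contract (ext_vec v) M == 0).
Proof.
pose F v : exterior X := [ffun S => theta (contract (ext_vec v) M S)].
have contractL a x y : contract (ext_vec (a *: x + y)) M =
    theta a *: contract (ext_vec x) M + contract (ext_vec y) M.
  apply/esym/contract_unique => L.
  by rewrite ext_inner_linearr !contractP ext_vec_linear wedge_linearl ext_inner_semilinearl.
have FL : linear F.
  move=> a x y; apply: exteriorP => S; rewrite exteriorDE exteriorZE !ffunE contractL.
  by rewrite exteriorDE exteriorZE rmorphD rmorphM /= rmorphK.
pose F_lin := GRing.isLinear.Build _ _ _ _ F FL.
pose F0 : {linear X -> exterior X} := HB.pack F F_lin.
rewrite memv_ker -[linfun _]/(linfun F0) lfunE /=.
apply/eqP/eqP => [F0v|Q0]; apply: exteriorP => S.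
  have := congr1 (fun N : exterior X => N S) F0v.
  by rewrite !ffunE => /eqP; rewrite fmorph_eq0 => /eqP.
by rewrite !ffunE Q0 ffunE rmorph0.
Qed.

Lemma outer_spaceP w M :
  reflect (forall v, contract (ext_vec v) M = 0 -> inner v w = 0) (w \in outer_space M).
Proof.
apply: (iffP mem_orthovP) => H v.
  by move=> /eqP vM; apply: H; rewrite mem_left_kernel.
by rewrite mem_left_kernel => /eqP; apply: H.
Qed.

End InnerProductTheory.

(* Main.v *)
From HB Require Import structures.
Require Import Defs.
From mathcomp Require Import all_boot all_order all_algebra.
From mathcomp Require Import reals.
From mathcomp Require Import zify.

Set Implicit Arguments.
Unset Strict Implicit.
Unset Printing Implicit Defensive.

Import GRing.Theory Num.Theory.
Local Open Scope ring_scope.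

(* If v lies in the inner space of M + N, then v /\ M = - (v /\ N) is killed by
   exterior multiplication by every vector of both inner spaces.  A nonzero
   element of grade at most t + 1 cannot be killed by a space of dimension
   t + 2, hence v /\ M = v /\ N = 0.  This argument only uses that exterior
   multiplications anticommute and that contractions provide adjoint operators
   satisfying the canonical anticommutation relations; exchanging the two roles
   and replacing the grade p by n - p, it applies to the orthogonal complements
   of the outer spaces and gives the second half. *)

(** * Orthogonal complements for the form [ip] *)

Section Orthogonal.
Variables (K : numFieldType) (theta : involutive_rmorphism K).
Variables (X : vectType K) (ip : {dot X for theta}).
Implicit Types (v : X) (U V : {vspace X}).

Lemma dot_neq0 v : v != 0 -> ip v v != 0.
Proof. by move=> /(@neq0_dnorm_gt0 _ _ _ ip)/lt0r_neq0. Qed.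

Lemma cap_orthov V : (V :&: orthov ip V = 0)%VS.
Proof.
apply/eqP; rewrite -subv0; apply/subvP => v; rewrite memv_cap memv0.
move=> /andP[vV /mem_orthovP /(_ v vV)].
by have [//|/dot_neq0/eqP] := eqVneq v 0.
Qed.

(** [V] meets its complement trivially, which gives one inequality. For the other, each of the
    [\dim V] basis vectors imposes one condition, costing at most one dimension. *)
Lemma dim_orthov V : (\dim (orthov ip V) + \dim V = \dim {:X})%N.
Proof.
apply/eqP; rewrite eqn_leq; apply/andP; split.
  rewrite addnC -dimv_disjoint_sum ?cap_orthov //; exact/dimvS/subvf.
have dim_bigcap (f : nat -> X) k :
    (\dim {:X} <= \dim (\bigcap_(i < k) orthov ip <[f i]>)%VS + k)%N.
  elim: k => [|k IH]; first by rewrite big_ord0 addn0.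
  apply: (leq_trans IH); rewrite big_ord_recr /= addnS.
  have := leq_dim_orthov1 ip (f k) (\bigcap_(i < k) orthov ip <[f i]>)%VS.
  by rewrite -addSn leq_add2r; case: (\dim _).
have := dim_bigcap (fun i => (vbasis V)`_i) (\dim V).
by under eq_bigr => i _ do rewrite orthov1E.
Qed.

Lemma orthov_add U V :
  orthov ip (U + V)%VS = (orthov ip U :&: orthov ip V)%VS.
Proof.
apply/eqP; rewrite eqEsubv subv_cap -orthovD subvv /=.
by rewrite orthovD capvSl capvSr.
Qed.

(** One inclusion holds because complements reverse inclusions; equality follows by counting
    dimensions, with [orthov_add] handling the intersection of the complements. *)
Lemma orthov_cap U V :
  orthov ip (U :&: V)%VS = (orthov ip U + orthov ip V)%VS.
Proof.
have dimC W : \dim (orthov ip W) = (\dim {:X} - \dim W)%N.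
  by rewrite -(dim_orthov W) addnK.
apply/esym/eqP; rewrite eqEdim subv_add -andbA; apply/and3P; split.
- by rewrite orthov_sym; apply: subv_trans (capvSl _ _) _; rewrite orthov_sym.
- by rewrite orthov_sym; apply: subv_trans (capvSr _ _) _; rewrite orthov_sym.
have := dimv_sum_cap (orthov ip U) (orthov ip V).
rewrite -orthov_add !dimC; have := dimv_sum_cap U V.
have := dim_orthov (U + V); have := dim_orthov (U :&: V).
have := dim_orthov U; have := dim_orthov V.
lia.
Qed.

End Orthogonal.

(** * Abstract creation and annihilation operators *)

Section CreationAnnihilation.
Variables (K : numFieldType) (theta : involutive_rmorphism K).
Variables (X : vectType K) (ip : {dot X for theta}) (E : lmodType K).
(** [c] is kept apart from [ip] because the two applications need opposite argument orders: [ip v w]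
    when [A] is exterior multiplication, [inner ip v w] when [A] is contraction. *)
Variables (A B : X -> {linear E -> E}) (gr : nat -> {linear E -> E}).
Variables (c : X -> X -> K) (ker : E -> {vspace X}).
Hypothesis mem_ker : forall v M, (v \in ker M) = (A v M == 0).
Hypothesis A_anticomm : forall v w M, A v (A w M) = - A w (A v M).
Hypothesis AB_anticomm : forall v w M, A v (B w M) + B w (A v M) = c v w *: M.
Hypothesis c_neq0 : forall v, v != 0 -> c v v != 0.
Hypothesis c_ortho : forall u v, ip u v = 0 -> c u v = 0.
Hypothesis gr_A : forall p v M, gr p.+1 (A v M) = A v (gr p M).
Hypothesis gr0_A : forall v M, gr 0 (A v M) = 0.

(* If [A v M = 0] then [M] is proportional to [A v (B v M)], so passing to
   [B v M] lowers the grade by one and the kernel by at most one dimension. *)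
Lemma dim_ker_le p M : gr p M != 0 -> (\dim (ker M) <= p)%N.
Proof.
elim: p M => [|p IH] M grM.
all: have [->|kM0] := eqVneq (ker M) 0%VS; first by rewrite dimv0.
all: have [v vM v0] : exists2 v, v \in ker M & v != 0.
1,3: by exists (vpick (ker M)); rewrite ?memv_pick ?vpick0.
all: have cM : c v v *: M = A v (B v M).
1,3: by move: vM; rewrite -AB_anticomm mem_ker => /eqP->; rewrite linear0 addr0.
  have := gr0_A v (B v M); rewrite -cM linearZ => /eqP.
  by rewrite scaler_eq0 (negbTE grM) (negbTE (c_neq0 v0)).
have grB : gr p (B v M) != 0.
  apply: contra grM => /eqP grB0; have := gr_A p v (B v M).
  rewrite grB0 linear0 -cM linearZ => /eqP.
  by rewrite scaler_eq0 (negbTE (c_neq0 v0)).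
(* If [A u M = 0] and [c u v = 0], then [A u (B v M) = - B v (A u M) = 0]; orthogonality to [v]
   costs at most one dimension. *)
suff sub : (ker M :&: orthov ip <[v]> <= ker (B v M))%VS.
  have := leq_dim_orthov1 ip v (ker M); have := dimvS sub; have := IH _ grB.
  lia.
apply/subvP => u; rewrite memv_cap mem_orthov1 !mem_ker => /andP[/eqP uM /eqP uv].
have := AB_anticomm u v M.
by rewrite uM linear0 addr0 c_ortho // scale0r => ->.
Qed.

Hypothesis gr_neq0 : forall M, M != 0 -> exists p, gr p M != 0.

Lemma balanced_ker M N bM bN tM tN :
    gr bM M != 0 -> gr bN N != 0 ->
    (forall p, (tM < p)%N -> gr p M = 0) ->
    (forall p, (tN < p)%N -> gr p N = 0) ->
    (minn tM tN + 2 <= \dim (ker M + ker N))%N ->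
  ker (M + N) = (ker M :&: ker N)%VS /\
  (\dim (ker (M + N)) + 2 <= maxn bM bN)%N.
Proof.
move=> grM grN topM topN big_sum.
have bMt : (bM <= tM)%N by rewrite leqNgt; apply: contra grM => /topM ->.
have bNt : (bN <= tN)%N by rewrite leqNgt; apply: contra grN => /topN ->.
have eq_ker : ker (M + N) = (ker M :&: ker N)%VS.
  apply/eqP; rewrite eqEsubv andbC; apply/andP; split; apply/subvP => v.
    by rewrite memv_cap !mem_ker linearD => /andP[/eqP-> /eqP->]; rewrite addr0.
  rewrite memv_cap !mem_ker linearD addr_eq0 => /eqP AvMN.
  suff AvM0 : A v M = 0 by move: AvMN; rewrite AvM0 eqxx => /esym/eqP; rewrite oppr_eq0.
  apply/eqP; apply: contraTT big_sum => AvM_neq0.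
  rewrite -ltnNge addn2 ltnS.
  (* Vectors killing [M] anticommute past [A v]; so do those killing [N], since
     [A v M = - A v N]. *)
  have sub : (ker M + ker N <= ker (A v M))%VS.
    rewrite subv_add; apply/andP; split; apply/subvP => u.
      by rewrite !mem_ker A_anticomm => /eqP->; rewrite linear0 oppr0.
    by rewrite !mem_ker AvMN linearN A_anticomm => /eqP->; rewrite linear0 !oppr0.
  apply: (leq_trans (dimvS sub)).
  have [[|p] grp] := gr_neq0 AvM_neq0; first by rewrite gr0_A eqxx in grp.
  apply: (leq_trans (dim_ker_le grp)); rewrite ltnS leq_min.
  (* A nonzero part of grade [p.+1] of [A v M] comes from grade [p] of [M] and, up to sign, of [N],
     so [p] exceeds neither [tM] nor [tN]. *)
  apply/andP; split; rewrite leqNgt; apply: contra grp.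
    by move=> /topM grM0; rewrite gr_A grM0 linear0.
  by move=> /topN grN0; rewrite AvMN linearN gr_A grN0 linear0 oppr0.
split=> //; rewrite eq_ker.
(* The intersection has dimension at most [bM + bN - (minn tM tN + 2)], and
   [minn bM bN <= minn tM tN]. *)
have := dimv_sum_cap (ker M) (ker N).
have := dim_ker_le grM; have := dim_ker_le grN.
lia.
Qed.

End CreationAnnihilation.

(** * Exterior multiplication by vectors and the grading *)

HB.instance Definition _ (K : fieldType) (X : vectType K) (M : exterior X) :=
  GRing.isLinear.Build K (exterior X) (exterior X) *:%R (wedge M)
    (wedge_linearr M).

Section Grades.
Variables (K : fieldType) (X : vectType K).
Implicit Types (v w : X) (M : exterior X) (p : nat).

Lemma grade_part_linear p : linear (@grade_part K X p).
Proof.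
move=> a M N; apply: exteriorP => S; rewrite exteriorDE exteriorZE !ffunE.
by case: eqP => _; rewrite ?exteriorDE ?exteriorZE // mulr0 addr0.
Qed.

HB.instance Definition _ p :=
  GRing.isLinear.Build K (exterior X) (exterior X) *:%R (@grade_part K X p)
    (grade_part_linear p).

Lemma grade_part_wedge p v M :
  grade_part p.+1 (wedge (ext_vec v) M) = wedge (ext_vec v) (grade_part p M).
Proof.
apply: exteriorP => S; rewrite ffunE !wedge_vecE.
case: eqP => cardS; [|apply/esym; rewrite big1 // => i iS].
  apply: eq_bigr => i iS; rewrite ffunE ifT //.
  by move: cardS; rewrite (cardsD1 i) iS add1n => -[->].
rewrite ffunE ifF ?mulr0 //; apply/eqP => cardD; apply: cardS.
by rewrite (cardsD1 i) iS cardD.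
Qed.

Lemma grade_part0_wedge v M : grade_part 0 (wedge (ext_vec v) M) = 0.
Proof.
apply: exteriorP => S; rewrite ffunE wedge_vecE [RHS]ffunE cards_eq0.
by case: eqP => // ->; rewrite big_set0.
Qed.

(** Polarisation: expanding the vanishing square of [v + w] leaves the two mixed terms. *)
Lemma wedge_vec_anticomm v w M :
  wedge (ext_vec v) (wedge (ext_vec w) M) =
  - wedge (ext_vec w) (wedge (ext_vec v) M).
Proof.
have wedgeDl L L' P : wedge (L + L') P = wedge L P + wedge L' P :> exterior X.
  by have := wedge_linearl P 1 L L'; rewrite !scale1r.
have ext_vecD : ext_vec (v + w) = ext_vec v + ext_vec w.
  by have := ext_vec_linear 1 v w; rewrite !scale1r.
have vecK x : wedge (ext_vec x) (wedge (ext_vec x) M) = 0.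
  rewrite wedgeA ext_vec_sq.
  by have := wedge_linearl M (-1) 0 0; rewrite scaler0 addr0 scaleN1r addNr.
have := vecK (v + w); rewrite ext_vecD !wedgeDl !linearD /=.
by rewrite !vecK add0r addr0 => /eqP; rewrite addr_eq0 => /eqP.
Qed.

End Grades.

(** * Contraction by vectors as the adjoint of exterior multiplication *)

Section Contraction.
Variables (K : numFieldType) (theta : involutive_rmorphism K).
Variables (X : vectType K) (ip : {dot X for theta}).
Implicit Types (v w x : X) (L M N : exterior X) (xs ys : seq X) (p : nat).

HB.instance Definition _ M :=
  GRing.isLinear.Build K (exterior X) K *%R (ext_inner ip M)
    (ext_inner_linearr ip M).

Lemma ext_innerDl L M N : ext_inner ip (L + M) N = ext_inner ip L N + ext_inner ip M N.
Proof.
by have := ext_inner_semilinearl ip N 1 L M; rewrite scale1r rmorph1 mul1r.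
Qed.

Lemma ext_inner0l N : ext_inner ip 0 N = 0.
Proof. by apply: (addrI (ext_inner ip 0 N)); rewrite -ext_innerDl !addr0. Qed.

Lemma ext_innerZl a L N : ext_inner ip (a *: L) N = theta a * ext_inner ip L N.
Proof.
by have := ext_inner_semilinearl ip N a L 0; rewrite addr0 ext_inner0l addr0.
Qed.

Lemma ext_inner_inj M N :
  (forall L, ext_inner ip L M = ext_inner ip L N) -> M = N.
Proof.
move=> MN; apply/eqP; rewrite -subr_eq0; apply/eqP/(@ext_inner_nondeg _ _ _ ip).
by move=> L; rewrite linearB /= MN subrr.
Qed.

Lemma ext_inner_wedge_seq_inj M N :
  (forall xs, ext_inner ip (wedge_seq xs) M = ext_inner ip (wedge_seq xs) N) ->
  M = N.
Proof.
move=> MN; apply: ext_inner_inj => L; rewrite (exterior_sum_blade L).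
elim/big_ind: _ => [|L1 L2 IH1 IH2|S _]; first by rewrite !ext_inner0l.
  by rewrite !ext_innerDl IH1 IH2.
by rewrite !ext_innerZl MN.
Qed.

(** Grade projections are self-adjoint because [gram_det] is 0 on lists of different lengths, so
    distinct grades are orthogonal. *)
Lemma ext_inner_grade_part p M N :
  ext_inner ip (grade_part p M) N = ext_inner ip M (grade_part p N).
Proof.
apply: eq_bigr => S _; apply: eq_bigr => T _; rewrite !ffunE /gram_det !size_blade.
case: (eqVneq #|S| #|T|) => [->|_]; last by rewrite !mulr0 !mul0r.
by case: eqP => _; rewrite // rmorph0 mulr0 !mul0r.
Qed.

Lemma contract_linear M : linear (contract ip M).
Proof.
move=> a N P; apply: ext_inner_inj => L.
by rewrite linearP /= !contractP linearP.
Qed.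

HB.instance Definition _ M :=
  GRing.isLinear.Build K (exterior X) (exterior X) *:%R (contract ip M)
    (contract_linear M).

Lemma grade_part_contract p v M :
  grade_part p (contract ip (ext_vec v) M) =
  contract ip (ext_vec v) (grade_part p.+1 M).
Proof.
apply: ext_inner_inj => L.
by rewrite -ext_inner_grade_part !contractP -grade_part_wedge ext_inner_grade_part.
Qed.

Lemma contract_grade_part0 v M : contract ip (ext_vec v) (grade_part 0 M) = 0.
Proof.
apply: ext_inner_inj => L; rewrite contractP -ext_inner_grade_part.
by rewrite grade_part0_wedge ext_inner0l linear0.
Qed.

Lemma contract_vec_anticomm v w M :
  contract ip (ext_vec v) (contract ip (ext_vec w) M) =
  - contract ip (ext_vec w) (contract ip (ext_vec v) M).
Proof.
apply/eqP; rewrite -addr_eq0; apply/eqP/ext_inner_inj => L.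
rewrite linearD linear0 /= !contractP -ext_innerDl wedge_vec_anticomm addNr.
exact: ext_inner0l.
Qed.

(* Laplace expansion along the row of [v]. *)
Lemma gram_det_cons v xs ys :
  gram_det ip (v :: xs) ys = \sum_(j < size ys)
    (-1) ^+ j * inner ip v ys`_j * gram_det ip xs (take j ys ++ drop j.+1 ys).
Proof.
have size_del j : (j < size ys)%N -> size (take j ys ++ drop j.+1 ys) = (size ys).-1.
  by move=> jys; rewrite size_cat size_drop size_takel 1?ltnW //; lia.
rewrite {1}/gram_det /=; case: eqP => [sz|nsz]; last first.
  rewrite big1 // => j _; rewrite /gram_det size_del // ifN ?mulr0 //.
  apply: contra_notN nsz => /eqP->; have := ltn_ord j; lia.
rewrite -sz (expand_det_row _ ord0); apply: eq_bigr => j _.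
have jys : (j < size ys)%N by rewrite -sz.
rewrite /cofactor mxE /= add0n mulrA [_ * inner _ _ _]mulrC /gram_det.
rewrite size_del // -sz eqxx; congr (_ * \det _); apply/matrixP => i k.
rewrite !mxE nth_cat size_take jys /= /bump.
case: leqP => jk; last by rewrite add0n nth_take.
by rewrite -[RHS]/(inner ip xs`_i (drop j.+1 ys)`_(k - j)) nth_drop add1n addSn subnKC.
Qed.

(** Paired with [wedge_seq xs], both sides become the Laplace expansion of the Gram determinant of
    [v :: xs] and [ys]. *)
Lemma contract_wedge_seq v ys :
  contract ip (ext_vec v) (wedge_seq ys) = \sum_(j < size ys)
    ((-1) ^+ j * inner ip v ys`_j) *: wedge_seq (take j ys ++ drop j.+1 ys).
Proof.
apply: (@ext_inner_wedge_seq_inj) => xs.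
rewrite contractP -[wedge _ _]/(wedge_seq (v :: xs)) ext_inner_wedge_seq.
rewrite linear_sum gram_det_cons; apply: eq_bigr => j _ /=.
by rewrite linearZ /= ext_inner_wedge_seq.
Qed.

Lemma contract_wedge v w M :
  contract ip (ext_vec v) (wedge (ext_vec w) M) +
  wedge (ext_vec w) (contract ip (ext_vec v) M) = inner ip v w *: M.
Proof.
rewrite (exterior_sum_blade M).
elim/big_ind: _ => [|M1 M2 IH1 IH2|S _]; first by rewrite !linear0 addr0.
  by rewrite !linearD /= addrACA IH1 IH2.
rewrite !linearZ /= -scalerDr; congr (_ *: _).
rewrite -[wedge (ext_vec w) (wedge_seq (blade S))]/(wedge_seq (w :: blade S)) !contract_wedge_seq /=.
(* The term of index 0 is the right-hand side. Prepending [w] shifts the other indices by one and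
   flips their signs, so they cancel the second summand. *)
rewrite big_ord_recl /= drop0 expr0 mul1r linear_sum -addrA -big_split /=.
rewrite big1 ?addr0 // => j _.
by rewrite linearZ /= exprS mulN1r mulNr scaleNr addNr.
Qed.

End Contraction.

(** * Grades counted from the top *)

Section Codegree.
Variables (K : fieldType) (X : vectType K).
Local Notation n := (\dim {:X}).
Implicit Types (M : exterior X) (q : nat).

(** With this indexing contraction raises the index, as [gr_A] requires. The guard is needed since
    truncated subtraction would give the grade 0 part for every [q > n]. *)
Definition cograde_part q M : exterior X :=
  if (q <= n)%N then grade_part (n - q)%N M else 0.

Lemma cograde_part_linear q : linear (cograde_part q).
Proof.
by move=> a M N; rewrite /cograde_part; case: ifP; rewrite ?linearP // scaler0 addr0.
Qed.

HB.instance Definition _ q :=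
  GRing.isLinear.Build K (exterior X) (exterior X) *:%R (cograde_part q)
    (cograde_part_linear q).

Lemma cograde_part_sub p M : (p <= n)%N -> cograde_part (n - p)%N M = grade_part p M.
Proof. by move=> pn; rewrite /cograde_part leq_subr subKn. Qed.

End Codegree.

(** * Application to inner and outer spaces *)

Section Balanced.
Variables (K : numFieldType) (theta : involutive_rmorphism K).
Variables (X : vectType K) (ip : {dot X for theta}).
Local Notation n := (\dim {:X}).
Implicit Types (M N : exterior X) (p : nat).

Lemma grade_part_gt_top M p : M != 0 -> (top_grade M < p)%N -> grade_part p M = 0.
Proof.
move=> /top_gradeP[_ topM] ltp; apply/eqP; apply: contraTT ltp => /topM.
by rewrite -leqNgt.
Qed.

Lemma grade_part_lt_bottom M p :
  M != 0 -> (p < bottom_grade M)%N -> grade_part p M = 0.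
Proof.
move=> /bottom_gradeP[_ botM] ltp; apply/eqP; apply: contraTT ltp => /botM.
by rewrite -leqNgt.
Qed.

Lemma grade_le_dim p M : grade_part p M != 0 -> (p <= n)%N.
Proof. by move=> grM; rewrite leqNgt; apply: contra grM => /grade_part_out->. Qed.

Lemma inner_space_balanced M N : M != 0 -> N != 0 ->
    (minn (top_grade M) (top_grade N) + 2 <=
       \dim (inner_space M + inner_space N))%N ->
  inner_space (M + N) = (inner_space M :&: inner_space N)%VS /\
  (inner_grade (M + N)%R + 2 <= maxn (bottom_grade M) (bottom_grade N))%N.
Proof.
move=> M0 N0.
have [grM _] := bottom_gradeP M0; have [grN _] := bottom_gradeP N0.
apply: (@balanced_ker K theta X ip (exterior X) (fun v => wedge (ext_vec v))
  (fun w => contract ip (ext_vec w)) (@grade_part K X) (fun v w => ip v w)) => //.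
- exact: mem_inner_space.
- exact: wedge_vec_anticomm.
- by move=> v w P; rewrite addrC contract_wedge.
- exact: dot_neq0.
- by move=> p v P; apply: grade_part_wedge.
- exact: grade_part0_wedge.
- by move=> P /exterior_neq0_grade[p grP]; exists p.
- by move=> p; apply: grade_part_gt_top.
- by move=> p; apply: grade_part_gt_top.
Qed.

(** Counting from the top swaps the extremes: the lowest nonzero index is [n - top_grade], the
    highest [n - bottom_grade]. *)
Lemma left_kernel_balanced M N : M != 0 -> N != 0 ->
    (minn (n - bottom_grade M) (n - bottom_grade N) + 2 <=
       \dim (left_kernel ip M + left_kernel ip N))%N ->
  left_kernel ip (M + N) = (left_kernel ip M :&: left_kernel ip N)%VS /\
  (\dim (left_kernel ip (M + N)%R) + 2 <=
     maxn (n - top_grade M) (n - top_grade N))%N.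
Proof.
move=> M0 N0.
have cograde_neq0 (P : exterior X) : P != 0 -> cograde_part (n - top_grade P)%N P != 0.
  by move=> /top_gradeP[grP _]; rewrite cograde_part_sub // (grade_le_dim grP).
have cograde_gt (P : exterior X) p : P != 0 -> (n - bottom_grade P < p)%N -> cograde_part p P = 0.
  move=> P0 ltp; rewrite /cograde_part; case: ifP => // pn.
  by apply: grade_part_lt_bottom => //; lia.
apply: (@balanced_ker K theta X ip (exterior X)
  (fun v => contract ip (ext_vec v)) (fun w => wedge (ext_vec w))
  (@cograde_part K X) (inner ip)).
- exact: mem_left_kernel.
- exact: contract_vec_anticomm.
- exact: contract_wedge.
- exact: dot_neq0.
- by move=> u v /eqP; rewrite herm_eq0C => /eqP.
- move=> q v P; rewrite /= /cograde_part; case: ltnP => [lt_qn|le_nq].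
    by rewrite grade_part_contract subnSK // ltnW.
  (* Here only [q = n] has content: the part is of grade 0, which every contraction kills. *)
  by case: ifP => _; rewrite ?linear0 // (eqnP le_nq) contract_grade_part0.
(* Grade [n] of a contraction would come from grade [n.+1], which is zero. *)
- move=> v P; rewrite /= /cograde_part leq0n subn0 grade_part_contract.
  by rewrite grade_part_out // linear0.
- move=> P /exterior_neq0_grade[p grP]; exists (n - p)%N.
  by rewrite /= cograde_part_sub // (grade_le_dim grP).
- exact: cograde_neq0.
- exact: cograde_neq0.
- by move=> p; apply: cograde_gt.
- by move=> p; apply: cograde_gt.
Qed.

(** Complements exchange sums with intersections and dimension [d] with [n - d], turning the
    statement for left kernels into this one. *)
Lemma outer_space_balanced M N : M != 0 -> N != 0 ->
    (\dim (outer_space ip M :&: outer_space ip N) + 2 <=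
       maxn (bottom_grade M) (bottom_grade N))%N ->
  outer_space ip (M + N) = (outer_space ip M + outer_space ip N)%VS /\
  (minn (top_grade M) (top_grade N) + 2 <= outer_grade ip (M + N)%R)%N.
Proof.
move=> M0 N0 small_cap.
have [grM _] := bottom_gradeP M0; have [grN _] := bottom_gradeP N0.
(* These bounds make the truncated subtractions [n - bottom_grade] exact. *)
have bMn := grade_le_dim grM; have bNn := grade_le_dim grN.
have := dim_orthov ip (left_kernel ip M + left_kernel ip N).
rewrite orthov_add => dim_cap.
have [|eq_ker small_ker] := left_kernel_balanced M0 N0.
  by move: small_cap dim_cap; rewrite /outer_space; lia.
split; first by rewrite /outer_space eq_ker orthov_cap.
rewrite /outer_grade /outer_space.
have := dim_orthov ip (left_kernel ip (M + N)).
lia.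
Qed.

End Balanced.

Theorem theorem4p3 (R : realType) (s : space_kind)
    (X : vectType (scalars R s)) (ip : {dot X for conjugation R s})
    (M N : exterior X) (hM : M != 0) (hN : N != 0) :
  let b := maxn (bottom_grade M) (bottom_grade N) in
  let t := minn (top_grade M) (top_grade N) in
  ((t + 2 <= \dim (inner_space M + inner_space N))%N ->
     inner_space (M + N) = (inner_space M :&: inner_space N)%VS /\
     (inner_grade (M + N)%R + 2 <= b)%N) /\
  ((\dim (outer_space ip M :&: outer_space ip N) + 2 <= b)%N ->
     outer_space ip (M + N) = (outer_space ip M + outer_space ip N)%VS /\
     (t + 2 <= outer_grade ip (M + N)%R)%N).
Proof.
by split; [exact: (inner_space_balanced ip hM hN) | exact: (outer_space_balanced hM hN)].
Qed.
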